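(* Let $G=(V,E)$ be a finite connected graph and let $\beta\in\mathcal{P}_+(E)$. Consider the problem of minimizing $\sum_{\gamma\in\Gamma}\sigma[\gamma]$ (which equals $|V|^{-1}\det{}' L_\sigma$) over all $\sigma\in\mathbb{R}^E_{>0}$ satisfying $\prod_{e\in E}\sigma(e)^{\beta(e)}=1$. The determinant in this problem is bounded away from zero (i.e. the infimum is strictly positive) if and only if $G$ is $\beta$-homogeneous. A minimizing choice of $\sigma$ exists if and only if $G$ is strictly $\beta$-homogeneous.
   Context: $G=(V,E)$ is a finite connected undirected graph; multi-edges are allowed, self-loops are not. $\Gamma$ is the set of all spanning trees of $G$ (viewed as edge sets). $\mathcal{P}(X)$ is the set of probability mass functions (pmfs) on a finite set $X$, and $\mathcal{P}_+(X)$ the set of strictly positive ones. For $\sigma\in\mathbb{R}^E_{>0}$ and $\gamma\in\Gamma$, $\sigma[\gamma]=\prod_{e\in\gamma}\sigma(e)$. $L_\sigma$ is the weighted graph Laplacian and $\det{}'L_\sigma$ is the product of its $|V|-1$ positive eigenvalues; by Kirchhoff's matrix tree theorem $\det{}'L_\sigma=|V|\sum_{\gamma\in\Gamma}\sigma[\gamma]$. For $\mu\in\mathcal{P}(\Gamma)$, the edge usage probability vector is $\eta_\mu(e)=\sum_{\gamma\in\Gamma,\,\gamma\ni e}\mu(\gamma)$. For $\sigma\in\mathbb{R}^E_{>0}$, $\mu_\sigma\in\mathcal{P}(\Gamma)$ is the pmf $\mu_\sigma(\gamma)=\sigma[\gamma]/\sum_{\gamma'\in\Gamma}\sigma[\gamma']$.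 $G$ is $\beta$-homogeneous if there exists $\mu\in\mathcal{P}(\Gamma)$ with $\eta_\mu(e)/(|V|-1)=\beta(e)$ for all $e\in E$; it is strictly $\beta$-homogeneous if this holds with $\mu=\mu_\sigma$ for some $\sigma\in\mathbb{R}^E_{>0}$. *)

(* Defs.v *)
From mathcomp Require Import all_boot all_order all_algebra.
From mathcomp Require Import all_classical all_reals exp.
From mathcomp Require Import polyrcf.

Set Implicit Arguments.
Unset Strict Implicit.
Unset Printing Implicit Defensive.

Import Order.TTheory GRing.Theory Num.Theory.
Local Open Scope classical_set_scope.
Local Open Scope ring_scope.

(* Parallel edges are distinct elements of [edge] with the same [ends]; since
   [ends e] has two elements there are no self-loops. *)
Record multigraph := Multigraph {
  vertex : finType;
  edge : finType;
  ends : edge -> {set vertex};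
  card_ends : forall e, #|ends e| = 2 }.

Section Graph.
Variable G : multigraph.
Implicit Type T : {set edge G}.

Definition adjacent T : rel (vertex G) :=
  fun u v => [exists e in T, ends e == [set u; v]%SET].

Definition connected_by T : bool :=
  (0 < #|vertex G|)%N && [forall u, forall v, connect (adjacent T) u v].

Definition graph_connected : bool := connected_by [set: edge G]%SET.

(* The edge following the i-th vertex of [vs] joins it to the cyclically next
   one; two parallel edges form a cycle of length 2. *)
Definition is_cycle (vs : seq (vertex G)) (es : seq (edge G)) : bool :=
  [&& (0 < size es)%N, uniq vs, uniq es &
      [seq ends e | e <- es] ==
      [seq [set p.1; p.2]%SET | p <- zip vs (rot 1 vs)]].

Definition acyclic T : Prop :=
  forall vs es, is_cycle vs es -> ~ {subset es <= T}.

Definition is_spanning_tree T : bool := connected_by T && `[< acyclic T >].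

Definition spanning_tree : finType := {T : {set edge G} | is_spanning_tree T}.

End Graph.

Section Pmf.
Variables (R : realType) (X : finType).

Definition is_pmf (p : X -> R) : Prop :=
  (forall x, 0 <= p x) /\ \sum_x p x = 1.

Definition is_pos_pmf (p : X -> R) : Prop :=
  is_pmf p /\ forall x, 0 < p x.

End Pmf.

(* The product of the positive eigenvalues of [A], each repeated according to
   its multiplicity as a root of the characteristic polynomial. *)
Definition pdet (R : realType) (n : nat) (A : 'M[R]_n) : R :=
  \prod_(x <- rootsR (char_poly A) | 0 < x) x ^+ mup x (char_poly A).

Section Weights.
Variables (R : realType) (G : multigraph).
Implicit Types (sigma beta : edge G -> R) (mu : spanning_tree G -> R).

Definition laplacian sigma : 'M[R]_#|vertex G| :=
  \matrix_(i, j)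
    if i == j then \sum_(e | enum_val i \in ends e) sigma e
    else - \sum_(e | ends e == [set enum_val i; enum_val j]%SET) sigma e.

Definition tree_weight sigma (t : spanning_tree G) : R :=
  \prod_(e in val t) sigma e.

Definition tree_sum sigma : R := \sum_t tree_weight sigma t.

Definition tree_pmf sigma (t : spanning_tree G) : R :=
  tree_weight sigma t / tree_sum sigma.

Definition edge_usage mu (e : edge G) : R :=
  \sum_(t : spanning_tree G | e \in val t) mu t.

Definition positive_weight sigma : Prop := forall e, 0 < sigma e.

Definition homogeneous beta : Prop :=
  exists mu, is_pmf mu /\
    forall e, edge_usage mu e / (#|vertex G|%:R - 1) = beta e.

Definition strictly_homogeneous beta : Prop :=
  exists sigma, positive_weight sigma /\
    forall e, edge_usage (tree_pmf sigma) e / (#|vertex G|%:R - 1) = beta e.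

Definition feasible beta : set (edge G -> R) :=
  [set sigma | positive_weight sigma /\ \prod_e sigma e `^ beta e = 1].

End Weights.

(* Main.v *)
From mathcomp Require Import sequences.
Require Import Defs.
From mathcomp Require Import all_boot all_order all_algebra.
From mathcomp Require Import all_classical all_reals exp.
From mathcomp Require Import perm polyrcf complex ring lra.
Import Order.TTheory GRing.Theory Num.Theory.
Local Open Scope ring_scope.

Set Implicit Arguments.
Unset Strict Implicit.
Unset Printing Implicit Defensive.

(** The determinant identity is a matrix tree theorem. Replace the row of a
    vertex [r] in the Laplacian by the unit row at [r]. Every other row [v] is
    a sum, over the edges [e] at [v], of [sigma e] times the difference of the
    unit rows at [v] and at the other end of [e], so by multilinearity the
    determinant is a sum over the ways of choosing a parent edge at each vertex
    other than [r]. Such a choice contributes its weight if following the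
    parents always leads to [r] (the Leibniz sum then has one nonzero term),
    and [0] otherwise (the indicator of the vertices that miss [r] is in the
    kernel). The choices that lead to [r] correspond to the spanning trees,
    whence [matrix_tree]. The characteristic polynomial of the symmetric
    Laplacian splits over the reals with nonnegative roots, one of which is
    [0]; its coefficient of degree 1 is, up to sign, the product of the other
    roots and also the sum over [r] of the determinants above, so that the
    product of the positive eigenvalues is [|V|] times the tree sum
    ([pdet_laplacian]).

    For the optimisation put [sigma = exp x]. The constraint becomes
    [<beta, x> = 0] and the tree sum becomes the sum over the trees [t] of
    [exp x(t)], where [x(t)] is the total of [x] on [t]. If [mu] is a pmf on
    trees with edge usage [(|V| - 1) beta], then [exp y >= 1 + y] gives
    [sum_t mu(t) exp x(t) >= 1 + (|V| - 1) <beta, x> = 1]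
    ([homogeneous_exp_sum_ge1]). As [mu <= 1], homogeneity bounds the tree sum
    below by [1]; applied to [mu_sigma] and to [x = ln (tau / sigma)], the same
    inequality shows that a rescaled [sigma] witnessing strict homogeneity is a
    minimizer. Conversely, if [G] is not homogeneous, Gordan's alternative
    ([gordan]) yields [x] with [<beta, x> = 0] and [x(t) < 0] for every tree
    [t]; here it matters that all trees have the same number of edges. Along
    [exp (s x)] the tree sum tends to [0]. Finally, at a minimizer the
    derivative of the tree sum vanishes in every direction orthogonal to
    [beta], so the edge usage of [mu_sigma] is a multiple of [beta]. *)

(** * Arborescences and spanning trees *)

Section Arborescences.
Variable G : multigraph.
Implicit Types (e : edge G) (u v r : vertex G) (T : {set edge G}).
Implicit Types (f : {ffun vertex G -> option (edge G)}).

(** The end of [e] other than [v]; the value is arbitrary when [v] is not an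
    end of [e]. *)
Definition other e v : vertex G := odflt v [pick u in (ends e :\ v)%SET].

Lemma ends_other e v : v \in ends e -> ends e = [set v; other e v]%SET.
Proof.
move=> ve; have /cards1P[u eu] : #|(ends e :\ v)%SET| == 1%N.
  by have := cardsD1 v (ends e); rewrite card_ends ve add1n => -[<-].
suff -> : other e v = u by rewrite -eu finset.setD1K.
rewrite /other; case: pickP => [w|/(_ u)]; first by rewrite eu inE => /eqP.
by rewrite eu !inE eqxx.
Qed.

Lemma other_neq e v : v \in ends e -> other e v != v.
Proof.
move=> ve; apply/eqP => ov; have := card_ends e.
by rewrite (ends_other ve) ov finset.setUid cards1.
Qed.

Lemma other_in e v : v \in ends e -> other e v \in ends e.
Proof. by move=> /ends_other ->; rewrite !inE eqxx orbT. Qed.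

Lemma ends_set2 e u v : ends e = [set u; v]%SET -> u != v.
Proof.
by move=> euv; have := card_ends e; rewrite euv cards2; case: (u != v).
Qed.

Lemma other_set2 e u v : ends e = [set u; v]%SET -> other e u = v.
Proof.
move=> euv; have uv := ends_set2 euv.
have ue : u \in ends e by rewrite euv !inE eqxx.
by have := other_neq ue; have := other_in ue; rewrite euv !inE => /orP[]/eqP->;
  rewrite ?eqxx.
Qed.

Lemma adjacentP T u v :
  reflect (exists2 e, e \in T & ends e = [set u; v]%SET) (adjacent T u v).
Proof.
apply: (iffP existsP) => [[e /andP[eT /eqP]]|[e eT ee]]; exists e => //.
by rewrite eT ee eqxx.
Qed.

Lemma adjacent_sym T : symmetric (adjacent T).
Proof.
move=> u v; apply/adjacentP/adjacentP => -[e eT ee]; exists e => //;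
by rewrite ee finset.setUC.
Qed.

(** The vertex reached from [v] through its parent edge [f v]; a vertex
    without a parent edge is its own parent. *)
Definition parent f v : vertex G := if f v is Some e then other e v else v.

(** [f] assigns to every vertex except [r] an edge at that vertex, and none
    to [r]. *)
Definition parent_map r f : bool :=
  [forall v, if f v is Some e then (v != r) && (v \in ends e) else v == r].

(** A parent map is an arborescence rooted at [r] when iterating [parent] from
    any vertex leads to [r]. *)
Definition arborescence r f : bool :=
  parent_map r f && [forall v, fconnect (parent f) v r].

(** The set of all parent edges. *)
Definition used_edges f : {set edge G} :=
  [set e | [exists v, f v == Some e]]%SET.

Lemma used_edgesP f e : reflect (exists v, f v = Some e) (e \in used_edges f).
Proof. by rewrite inE; apply: (iffP existsP) => -[v /eqP]; exists v. Qed.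

Lemma parent_map_root r f : parent_map r f -> f r = None.
Proof. by move=> /forallP/(_ r); case: (f r) => // e; rewrite eqxx. Qed.

Lemma parent_map_some r f v : parent_map r f -> v != r ->
  exists2 e, f v = Some e & v \in ends e.
Proof.
move=> /forallP/(_ v); case: (f v) => [e /andP[_ ve] _|/eqP ->].
  by exists e.
by rewrite eqxx.
Qed.

Lemma parent_map_ends r f v e : parent_map r f -> f v = Some e ->
  v != r /\ v \in ends e.
Proof. by move=> /forallP/(_ v) + fv; rewrite fv => /andP[]. Qed.

(** A depth function, decreasing towards the root, is what characterises
    arborescences among parent maps. *)
Lemma arborescence_depth r f : arborescence r f ->
  exists d : vertex G -> nat, forall v, v != r -> (d (parent f v) < d v)%N.
Proof.
case/andP=> pf /forallP cf; exists (fun v => findex (parent f) v r) => v vr.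
by rewrite [X in (_ < X)%N](fconnect_findex (cf v)) // eq_sym.
Qed.

Lemma depth_arborescence r f (d : vertex G -> nat) : parent_map r f ->
  (forall v, v != r -> (d (parent f v) < d v)%N) -> arborescence r f.
Proof.
move=> pf df; rewrite /arborescence pf; apply/forallP => v.
have [n] := ubnP (d v); elim: n v => // n IHn v dv.
have [->|vr] := eqVneq v r; first exact: connect0.
apply: connect_trans (fconnect1 _ _) (IHn _ _).
exact: leq_trans (df v vr) dv.
Qed.

(** Otherwise [u] and [v] would be the parents of each other. *)
Lemma arborescence_inj r f u v e : arborescence r f ->
  f u = Some e -> f v = Some e -> u = v.
Proof.
move=> af fu fv; have [d dP] := arborescence_depth af; have /andP[pf _] := af.
have [ur ue] := parent_map_ends pf fu; have [vr ve] := parent_map_ends pf fv.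
have [//|uv] := eqVneq u v.
have ee : ends e = [set u; v]%SET.
  by move: ve; rewrite (ends_other ue) !inE eq_sym (negPf uv) => /eqP ->.
move: (dP u ur) (dP v vr); rewrite /parent fu fv (other_set2 ee).
rewrite (@other_set2 e v u) 1?finset.setUC // => /ltnW.
by rewrite leqNgt => /negP.
Qed.

(** An iterated operation over the edges of an arborescence may be carried out
    over the vertices instead, the root contributing the neutral element. *)
Lemma big_used_edges (R : Type) (idx : R) (op : Monoid.com_law idx) r f
    (F : edge G -> R) : arborescence r f ->
  \big[op/idx]_(e in used_edges f) F e = \big[op/idx]_v oapp F idx (f v).
Proof.
move=> af; transitivity (\big[op/idx]_v \big[op/idx]_(e | f v == Some e) F e).
  rewrite (exchange_big_dep (mem (used_edges f))) /=; last first.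
    by move=> v e _ /eqP fv; apply/used_edgesP; exists v.
  apply: eq_bigr => e /used_edgesP[v fv]; rewrite (big_pred1 v) // => u.
  by apply/eqP/eqP => [fu|->//]; exact: arborescence_inj af fu fv.
apply: eq_bigr => v _; case: (f v) => [e|]; last by rewrite big_pred0.
by rewrite (big_pred1 e) // => e'; apply/eqP/eqP => [[->]|->].
Qed.

Lemma card_used_edges r f : arborescence r f ->
  #|used_edges f| = #|vertex G|.-1.
Proof.
move=> af; have /andP[pf _] := af.
rewrite -sum1_card (big_used_edges _ _ af) (bigD1 r) //= (parent_map_root pf).
rewrite add0n (eq_bigr (fun=> 1%N)) => [|v /(parent_map_some pf)[e ->] _ //].
by rewrite sum1_card -(cardC1 r); apply: eq_card => v; rewrite !inE.
Qed.

(** An edge used by an arborescence is the parent edge of its deeper end. *)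
Lemma used_edge_deeper r f (d : vertex G -> nat) e u v :
    parent_map r f -> (forall v, v != r -> (d (parent f v) < d v)%N) ->
    e \in used_edges f -> ends e = [set u; v]%SET -> (d v <= d u)%N ->
  f u = Some e.
Proof.
move=> pf df /used_edgesP[w fw] ee dvu.
have [wr] := parent_map_ends pf fw; rewrite ee !inE => /orP[]/eqP wE.
  by rewrite -wE.
have := df _ wr; rewrite wE in fw *.
rewrite /parent fw (@other_set2 _ _ u) 1?finset.setUC //.
by rewrite ltnNge dvu.
Qed.

Lemma connect_used_edges r f v : arborescence r f ->
  connect (adjacent (used_edges f)) v r.
Proof.
move=> /andP[pf /forallP/(_ v)]; apply: (connect_sub _) => u w /eqP <-.
rewrite /parent; case fu: (f u) => [e|]; last exact: connect0.
have [ur ue] := parent_map_ends pf fu.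
apply/connect1/adjacentP; exists e; last exact: ends_other.
by apply/used_edgesP; exists u.
Qed.

Lemma connected_used_edges r f : arborescence r f ->
  connected_by (used_edges f).
Proof.
move=> af; apply/andP; split; first by apply/card_gt0P; exists r.
apply/forallP => u; apply/forallP => v.
apply: connect_trans (connect_used_edges u af) _.
rewrite (sym_connect_sym (@adjacent_sym _)).
exact: connect_used_edges.
Qed.

Lemma nth_cycle_ends vs es (e0 : edge G) (v0 : vertex G) i :
    is_cycle vs es -> (i < size es)%N ->
  ends (nth e0 es i) = [set nth v0 vs i; nth v0 vs (i.+1 %% size es)]%SET.
Proof.
case/and4P=> es0 uvs ues /eqP eE isz.
have sz : size es = size vs.
  have := congr1 size eE; rewrite size_map => ->.
  by rewrite size_map size_zip size_rot minnn.
rewrite -(nth_map e0 (finset.set0 : {set vertex G})) // eE.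
rewrite (nth_map (v0, v0)) ?size_zip ?size_rot ?minnn -?sz //.
rewrite nth_zip ?size_rot //=; congr [set _; _]%SET.
case: vs sz {eE uvs} => [|v vs] /= sz; first by rewrite sz in isz.
rewrite rot1_cons nth_rcons sz.
move: isz; rewrite sz ltnS leq_eqVlt => /orP[/eqP ->|isz].
  by rewrite ltnn eqxx modnn.
by rewrite isz modn_small.
Qed.

(** The two cycle edges at a deepest vertex of a cycle would both be its parent
    edge. *)
Lemma acyclic_used_edges r f : arborescence r f -> acyclic (used_edges f).
Proof.
move=> af vs es cyc sub; have [d dP] := arborescence_depth af.
have /andP[pf _] := af; have /and4P[es0 uvs ues _] := cyc.
have [e0 _] : exists e, e \in es.
  by case: es es0 {cyc sub ues} => // e es _; exists e; rewrite mem_head.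
have n0 : (0 < size es)%N by [].
have endsE i := nth_cycle_ends e0 r (i := i) cyc.
pose D (i : 'I_(size es)) := d (nth r vs i).
have [i _ imax] := @arg_maxnP _ (Ordinal n0) predT D isT.
(* [i'] is the index cyclically preceding [i]. *)
pose i' := ((i + (size es).-1) %% size es)%N.
have i'lt : (i' < size es)%N by rewrite ltn_mod.
have i'S : (i'.+1 %% size es)%N = i.
  by rewrite -addn1 modnDml -addnA addn1 prednK // modnDr modn_small.
have iSlt : (i.+1 %% size es < size es)%N by rewrite ltn_mod.
have mem j : (j < size es)%N -> nth e0 es j \in used_edges f.
  by move=> js; apply: sub; exact: mem_nth.
have f1 : f (nth r vs i) = Some (nth e0 es i).
  apply: (used_edge_deeper pf dP (mem _ _) (endsE _ _)) => //.
  exact: (imax (Ordinal iSlt)).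
have f2 : f (nth r vs i) = Some (nth e0 es i').
  apply: (used_edge_deeper pf dP (mem _ i'lt) (v := nth r vs i')).
    by rewrite (endsE _ i'lt) i'S finset.setUC.
  exact: (imax (Ordinal i'lt)).
have /eqP : nth e0 es i = nth e0 es i' by move: f1; rewrite f2 => -[].
rewrite nth_uniq // => /eqP ii'.
have := ends_set2 (endsE _ (ltn_ord i)).
by rewrite [in X in (X %% _)%N]ii' i'S eqxx.
Qed.

Lemma spanning_tree_used_edges r f : arborescence r f ->
  is_spanning_tree (used_edges f).
Proof.
move=> af; apply/andP; split; first exact: connected_used_edges af.
by apply/asboolP; exact: acyclic_used_edges af.
Qed.

(** By induction on the depth: [f v] is the [g]-parent edge of [v] or of its
    parent [w], and in the latter case it would also be [f w]. *)
Lemma arborescence_unique r f g : arborescence r f -> arborescence r g ->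
  used_edges f = used_edges g -> f = g.
Proof.
move=> af ag ufg; have [d dP] := arborescence_depth af.
have /andP[pf _] := af; have /andP[pg _] := ag.
apply/ffunP => v; have [n] := ubnP (d v); elim: n v => // n IHn v dv.
have [->|vr] := eqVneq v r; first by rewrite !(@parent_map_root r).
have [e fv ve] := parent_map_some pf vr.
have := dP v vr; rewrite /parent fv => dov.
have : e \in used_edges g by rewrite -ufg; apply/used_edgesP; exists v.
case/used_edgesP => w gw; have [wr] := parent_map_ends pg gw.
rewrite (ends_other ve) !inE => /orP[]/eqP wE; first by rewrite -wE gw.
have fw : f w = Some e.
  by rewrite IHn // wE; exact: leq_trans dov dv.
by have := other_neq ve; rewrite -wE (arborescence_inj af fw fv) eqxx.
Qed.

(** The distance to [r] inside [T] serves as a depth function. *)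
Lemma connected_arborescence r T : connected_by T ->
  exists2 f, arborescence r f & used_edges f \subset T.
Proof.
case/andP=> _ /forallP cT.
have cp v : exists n, [exists p : n.-tuple (vertex G),
    path (adjacent T) v p && (last v p == r)].
  have /connectP[p pp ->] := forallP (cT v) r.
  by exists (size p); apply/existsP; exists (in_tuple p); rewrite pp eqxx.
pose d v := ex_minn (cp v).
have step v : v != r -> exists2 e, e \in T &
    (v \in ends e) && (d (other e v) < d v)%N.
  move=> vr; rewrite {2}/d; case: ex_minnP => n /existsP[[p /= /eqP sp]].
  case: p sp => [|u p] /= sp; first by rewrite (negPf vr).
  move=> /andP[/andP[/adjacentP[e eT ee] pp] lp] _; exists e => //.
  rewrite ee !inE eqxx /= (other_set2 ee) -sp /d.
  case: ex_minnP => m _ mmin; rewrite ltnS; apply: mmin.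
  by apply/existsP; exists (in_tuple p); rewrite pp.
pose f := [ffun v => if v == r then None else
  [pick e in T | (v \in ends e) && (d (other e v) < d v)%N]].
have fP v : v != r -> exists2 e, f v = Some e &
    [&& e \in T, v \in ends e & (d (other e v) < d v)%N].
  move=> vr; rewrite ffunE (negPf vr); case: pickP => [e eP|no].
    by exists e.
  by have [e eT eP] := step v vr; have := no e; rewrite /= eT eP.
have fr : f r = None by rewrite ffunE eqxx.
have pf : parent_map r f.
  apply/forallP => v; have [->|vr] := eqVneq v r; first by rewrite fr.
  by have [e -> /and3P[]] := fP v vr.
exists f.
  apply: (depth_arborescence (d := d) pf) => v vr.
  by rewrite /parent; have [e -> /and3P[]] := fP v vr.
apply/fintype.subsetP => e /used_edgesP[v fv].
have [vr _] := parent_map_ends pf fv.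
by have [e' + /and3P[]] := fP v vr; rewrite fv => -[->].
Qed.

Lemma path_edges T u p : path (adjacent T) u p -> uniq (u :: p) ->
  exists es, [/\ [seq ends e | e <- es] =
                 [seq [set q.1; q.2]%SET | q <- zip (belast u p) p],
                uniq es, {subset es <= T} &
                forall e, e \in es -> {subset ends e <= u :: p}].
Proof.
elim: p u => [|v p IHp] u; first by exists [::].
rewrite [path _ _ _]/= cons_uniq => /andP[/adjacentP[e eT ee] pp] /andP[uvp uu].
have [es [esE ues sub inp]] := IHp v pp uu.
exists (e :: es) => /=; split; first by rewrite esE ee.
- rewrite ues andbT; apply: contra uvp => /inp; apply.
  by rewrite ee !inE eqxx.
- by move=> e'; rewrite inE => /orP[/eqP ->//|]; exact: sub.
- move=> e'; rewrite inE => /orP[/eqP ->|/inp sube] w.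
    by rewrite ee !inE => /orP[]->; rewrite ?orbT.
  by move=> /sube wp; rewrite in_cons wp orbT.
Qed.

(** An edge of [T] outside the arborescence would close a cycle with the path
    that joins its ends inside the arborescence. *)
Lemma acyclic_used_edges_eq r f T : acyclic T -> arborescence r f ->
  used_edges f \subset T -> used_edges f = T.
Proof.
move=> aT af sub; apply/eqP; rewrite finset.eqEsubset sub /=.
apply/fintype.subsetP => e eT; apply/negPn/negP => eU.
have /card_gt0P[x xe] : (0 < #|ends e|)%N by rewrite card_ends.
have ee := ends_other xe; set y := other e x in ee.
have /andP[_ /forallP/(_ x)/forallP/(_ y)] := connected_used_edges af.
case/connectP => p0 pp0; case: (shortenP pp0) => p pp up _ yE.
have [es [esE ues esub _]] := path_edges pp up.
apply: (aT (x :: p) (rcons es e)).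
  rewrite /is_cycle size_rcons up rcons_uniq ues andbT /=.
  have -> : e \notin es by apply: contra eU; exact: esub.
  rewrite map_rcons esE rot1_cons lastI -yE zip_rcons ?size_belast //.
  by rewrite map_rcons /= [[set y; x]%SET]finset.setUC -ee.
move=> e'; rewrite mem_rcons inE => /orP[/eqP ->//|/esub].
exact: (fintype.subsetP sub).
Qed.

End Arborescences.

(** * The matrix tree theorem *)

Section MatrixTree.
Variables (R : realType) (G : multigraph).
Implicit Types (sigma : edge G -> R) (r v : vertex G).
Implicit Types (f : {ffun vertex G -> option (edge G)}).

(** The Laplacian with the row of [r] replaced by the unit row at [r]; its
    determinant is the principal minor obtained by deleting [r]. *)
Definition rooted_laplacian sigma r : 'M[R]_#|vertex G| :=
  \matrix_(i, j) if enum_val i == r then (i == j)%:R else laplacian sigma i j.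

(** Each row [v] of [rooted_laplacian sigma r] is a combination of elementary
    rows indexed by the possible values [a] of a parent map at [v]:
    [row_weight] is the coefficient and [row_entry] the elementary row. *)
Let row_weight sigma r v (a : option (edge G)) : R :=
  if a is Some e then (if (v != r) && (v \in ends e) then sigma e else 0)
  else (v == r)%:R.

Let row_entry v (a : option (edge G)) (j : 'I_#|vertex G|) : R :=
  (enum_rank v == j)%:R -
  (if a is Some e then (enum_rank (other e v) == j)%:R else 0).

(** The matrix of [v |-> v - parent f v], with the unit row where [f] is
    [None]. *)
Definition parent_mx f : 'M[R]_#|vertex G| :=
  \matrix_(i, j) row_entry (enum_val i) (f (enum_val i)) j.

Lemma sum_option (T : finType) (V : nmodType) (F : option T -> V) :
  \sum_a F a = F None + \sum_x F (Some x).
Proof.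
rewrite (bigD1 None) //=; congr (_ + _).
rewrite (reindex_omap Some id) /=; last by case.
by apply: eq_bigl => x; rewrite eqxx.
Qed.

Lemma laplacianE sigma i j :
  laplacian sigma i j = \sum_(e | enum_val i \in ends e)
    sigma e * ((i == j)%:R - (enum_rank (other e (enum_val i)) == j)%:R).
Proof.
rewrite mxE; have [<-|ij] := eqVneq i j.
  apply: eq_bigr => e ie; rewrite -[X in _ == X]enum_valK.
  by rewrite (inj_eq enum_rank_inj) (negPf (other_neq ie)) subr0 mulr1.
rewrite -sumrN big_mkcond [RHS]big_mkcond; apply: eq_bigr => e _.
have [ie|ie] := boolP (enum_val i \in ends e); last first.
  by case: eqP => // ee; case/negP: ie; rewrite ee !inE eqxx.
rewrite sub0r (can2_eq (@enum_rankK _) (@enum_valK _)).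
case: (eqVneq (other e (enum_val i)) (enum_val j)) => oe.
  by rewrite {1}(ends_other ie) oe eqxx mulrN mulr1.
case: eqP => [/other_set2 oe'|_]; last by rewrite oppr0 mulr0.
by rewrite oe' eqxx in oe.
Qed.

Lemma rooted_laplacianE sigma r i j :
  rooted_laplacian sigma r i j =
  \sum_a row_weight sigma r (enum_val i) a * row_entry (enum_val i) a j.
Proof.
rewrite mxE sum_option /= /row_entry /= enum_valK subr0.
have [->|ir] := eqVneq (enum_val i) r.
  by rewrite mul1r [X in _ + X]big1 ?addr0 // => e _; rewrite mul0r.
rewrite mul0r add0r laplacianE big_mkcond; apply: eq_bigr => e _.
by case: ifP; rewrite ?mul0r.
Qed.

Lemma prod_row_weight sigma r f :
  \prod_v row_weight sigma r v (f v) =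
  if parent_map r f then \prod_v oapp sigma 1 (f v) else 0.
Proof.
case: ifPn => [pf|].
  apply: eq_bigr => v _; move/forallP/(_ v): pf; rewrite /row_weight.
  by case: (f v) => [e ->|/eqP->]; rewrite ?eqxx.
rewrite negb_forall => /existsP[v fv]; rewrite (bigD1 v) //= /row_weight.
by case: (f v) fv => [e /negPf->|/negPf->]; rewrite mul0r.
Qed.

(** Multilinearity of the determinant in the rows. *)
Lemma det_rooted_laplacian_expand sigma r :
  \det (rooted_laplacian sigma r) =
  \sum_(f : {ffun vertex G -> option (edge G)} | parent_map r f)
     (\prod_v oapp sigma 1 (f v)) * \det (parent_mx f).
Proof.
transitivity (\sum_(f : {ffun vertex G -> option (edge G)})
                (\prod_v row_weight sigma r v (f v)) * \det (parent_mx f)).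
  have prodE (F : 'I_#|vertex G| -> R) : \prod_i F i = \prod_v F (enum_rank v).
    by apply: reindex; exact/onW_bij/enum_rank_bij.
  under [RHS]eq_bigr do rewrite mulr_sumr.
  rewrite exchange_big; apply: eq_bigr => s _ /=; rewrite prodE.
  under eq_bigr do rewrite rooted_laplacianE enum_rankK.
  rewrite bigA_distr_bigA mulr_sumr; apply: eq_bigr => f _.
  rewrite big_split mulrCA /=; congr (_ * (_ * _)).
  by rewrite prodE; apply: eq_bigr => v _; rewrite !mxE enum_rankK.
by rewrite [RHS]big_mkcond; apply: eq_bigr => f _; rewrite prod_row_weight;
  case: ifP; rewrite ?mul0r.
Qed.

Lemma parent_mxE r f i j : parent_map r f -> enum_val i != r ->
  parent_mx f i j = (i == j)%:R - (enum_rank (parent f (enum_val i)) == j)%:R.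
Proof.
move=> pf ir; rewrite mxE /row_entry enum_valK /parent.
by have [e ->] := parent_map_some pf ir.
Qed.

Lemma parent_mx_root r f i j : parent_map r f -> enum_val i = r ->
  parent_mx f i j = (i == j)%:R.
Proof.
by move=> pf ir; rewrite mxE /row_entry enum_valK ir (parent_map_root pf) subr0.
Qed.

(** Only the identity contributes to the Leibniz formula: a permutation [s]
    with a nonzero term sends every vertex to itself or to its parent, and by
    induction on the depth it fixes every vertex. *)
Lemma det_parent_mx_arborescence r f : arborescence r f ->
  \det (parent_mx f) = 1.
Proof.
move=> af; have [d dP] := arborescence_depth af; have /andP[pf _] := af.
have pneq v : v != r -> parent f v != v.
  by move=> vr; apply: contraL (dP v vr) => /eqP ->; rewrite ltnn.
rewrite /determinant (bigD1 (1%g : {perm _})) //= odd_perm1 mul1r.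
rewrite [X in X + _]big1 => [|i _]; last first.
  rewrite perm1; have [ir|ir] := eqVneq (enum_val i) r.
    by rewrite (parent_mx_root _ pf ir) eqxx.
  rewrite (parent_mxE _ pf ir) eqxx -[X in _ == X]enum_valK.
  by rewrite (inj_eq enum_rank_inj) (negPf (pneq _ ir)) subr0.
rewrite big1 ?addr0 // => s /eqP s1.
apply/eqP; rewrite mulf_eq0; apply/orP; right.
apply/negPn/negP => /prodf_neq0 sP; apply: s1; apply/permP => i; rewrite perm1.
have [n] := ubnP (d (enum_val i)); elim: n i => // n IHn i di.
have := sP i isT; have [ir|ir] := eqVneq (enum_val i) r.
  by rewrite (parent_mx_root _ pf ir); case: (eqVneq i (s i)); rewrite ?eqxx.
rewrite (parent_mxE _ pf ir); case: (eqVneq i (s i)) => [//|isi].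
case: (eqVneq _ (s i)) => [pi _|]; last by rewrite subr0 eqxx.
have /perm_inj : s (s i) = s i.
  by apply: IHn; rewrite -pi enum_rankK; exact: leq_trans (dP _ ir) di.
by move=> e; rewrite e eqxx in isi.
Qed.

(** The indicator of the vertices that do not lead to the root is in the
    kernel. *)
Lemma det_parent_mx_cyclic r f : parent_map r f -> ~~ arborescence r f ->
  \det (parent_mx f) = 0.
Proof.
move=> pf; rewrite /arborescence pf negb_forall => /existsP[w wr].
rewrite -det_tr; apply/eqP/det0P.
exists (\row_i (~~ fconnect (parent f) (enum_val i) r)%:R).
  apply/eqP => /rowP/(_ (enum_rank w)); rewrite !mxE enum_rankK wr.
  by move/eqP; rewrite oner_eq0.
apply/rowP => i; rewrite [RHS]mxE mxE.
have [ir|ir] := eqVneq (enum_val i) r.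
  rewrite big1 // => j _; rewrite 2!mxE (parent_mx_root _ pf ir).
  by case: eqP => [<-|_]; rewrite ?mulr0 // ir connect0 mul0r.
under eq_bigr do rewrite 2!mxE (parent_mxE _ pf ir) mulrBr.
rewrite big_split /= sumrN; under eq_bigr do rewrite mulrC.
have pick (k : 'I_#|vertex G|) (F : 'I_#|vertex G| -> R) :
    \sum_j (k == j)%:R * F j = F k.
  rewrite (bigD1 k) //= eqxx mul1r big1 ?addr0 // => j jk.
  by rewrite eq_sym (negPf jk) mul0r.
rewrite pick; under [X in _ - X]eq_bigr do rewrite mulrC.
rewrite pick enum_rankK.
suff -> : fconnect (parent f) (parent f (enum_val i)) r =
          fconnect (parent f) (enum_val i) r by rewrite subrr.
apply/idP/idP => [|ci]; first by apply: connect_trans; exact: fconnect1.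
have := fconnect_findex ci; rewrite eq_sym ir => /(_ isT) fi.
by rewrite -(iter_findex ci) fi iterSr fconnect_iter.
Qed.

(** The sum over the subtype of spanning trees, as a sum over edge sets. *)
Lemma tree_sum_set sigma :
  tree_sum sigma = \sum_(T | is_spanning_tree T) \prod_(e in T) sigma e.
Proof.
by rewrite (big_sub (fun T : {set edge G} => is_spanning_tree T)
  (fun T : {set edge G} => \prod_(e in T) sigma e)).
Qed.

Theorem matrix_tree sigma r : \det (rooted_laplacian sigma r) = tree_sum sigma.
Proof.
rewrite det_rooted_laplacian_expand (bigID (arborescence r)) /= addrC.
rewrite big1 ?add0r => [|f /andP[pf naf]]; last first.
  by rewrite (det_parent_mx_cyclic pf naf) mulr0.
rewrite (eq_bigl (arborescence r)) => [|f]; last first.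
  by rewrite /arborescence; case: parent_map.
rewrite tree_sum_set.
rewrite (partition_big (@used_edges G) (@is_spanning_tree G)) /=; last first.
  exact: spanning_tree_used_edges.
apply: eq_bigr => T /andP[cT /asboolP aT].
have [f af fT] := connected_arborescence r cT.
have fTE := acyclic_used_edges_eq aT af fT.
rewrite (big_pred1 f) => [|g /=].
  by rewrite (det_parent_mx_arborescence af) mulr1 -fTE (big_used_edges _ _ af).
apply/andP/eqP => [[ag /eqP gT]|->]; last by rewrite af fTE.
by apply: arborescence_unique ag af _; rewrite gT fTE.
Qed.

End MatrixTree.

(** * Characteristic polynomials of real symmetric matrices *)

Section CharPoly.

Lemma coef1_prod (K : comNzRingType) (I : eqType) (s : seq I)
    (F : I -> {poly K}) : uniq s ->
  (\prod_(i <- s) F i)`_1 =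
  \sum_(i <- s) (F i)`_1 * \prod_(j <- s | j != i) (F j)`_0.
Proof.
elim: s => [|i s IHs] /=; first by rewrite !big_nil coef1.
case/andP=> is_ us; rewrite !big_cons eqxx /= coefM 2!big_ord_recl big_ord0 /=.
rewrite addr0 addrC coef0_prod IHs //; congr (_ * _ + _).
  rewrite [RHS]big_seq_cond [LHS]big_seq_cond.
  apply: eq_bigl => j; case: (boolP (j \in s)) => //= js.
  by apply/esym; apply: contraNneq is_ => <-.
rewrite mulr_sumr [LHS]big_seq [RHS]big_seq; apply: eq_bigr => k ks.
rewrite big_cons; have -> : i != k by apply: contraNneq is_ => ->.
by rewrite mulrCA.
Qed.

Lemma char_poly_coef1 (K : comNzRingType) n (A : 'M[K]_n) :
  (char_poly A)`_1 = (-1) ^+ n.-1 *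
    \sum_r \det (\matrix_(i, j) if i == r then (i == j)%:R else A i j).
Proof.
rewrite /char_poly /determinant coef_sum exchange_big mulr_sumr /=.
apply: eq_bigr => s _.
rewrite -(rmorph_sign (@polyC K)) coefCM -mulr_sumr mulrCA; congr (_ * _).
rewrite coef1_prod ?index_enum_uniq // mulr_sumr; apply: eq_bigr => r _.
rewrite [in RHS](bigD1 r) //= !mxE eqxx coefB coefMn coefX coefC subr0 mulrCA.
congr (_ * _).
transitivity (\prod_(j | j != r) ((-1) * A j (s j))).
  apply: eq_bigr => j _; rewrite !mxE coefB coefMn coefX mul0rn coefC sub0r.
  by rewrite mulN1r.
rewrite big_split prodr_const cardC1 card_ord /=; congr (_ * _).
by apply: eq_bigr => j /negPf jr; rewrite mxE jr.
Qed.

(** The roots of the characteristic polynomial over [K[i]] are real: if [v] is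
    an eigenvector for [z], then both [z |v|^2] and [|v|^2] are invariant under
    conjugation. *)
Lemma symmetric_char_poly_split (K : rcfType) n (A : 'M[K]_n) : A^T = A ->
  exists s : seq K, char_poly A = \prod_(a <- s) ('X - a%:P).
Proof.
move=> symA; set f : {rmorphism K -> K[i]} := real_complex K.
have [zs] := closed_field_poly_normal (char_poly (map_mx f A)).
rewrite (monicP (char_poly_monic _)) scale1r => pE.
exists [seq complex.Re z | z <- zs].
apply: (@map_poly_inj _ _ f); rewrite map_char_poly pE.
rewrite rmorph_prod big_map big_seq [RHS]big_seq; apply: eq_bigr => z zz.
rewrite rmorphB /= map_polyX map_polyC; congr (_ - _%:P).
have /eigenvalueP[v vA v0] : eigenvalue (map_mx f A) z.
  by rewrite eigenvalue_root_char pE root_prod_XsubC.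
pose N := \sum_j v 0 j * (v 0 j)^*.
have N0 : N != 0.
  apply: contraNneq v0 => /eqP; rewrite psumr_eq0 => [/allP N0|j _]; last first.
    exact: mul_conjC_ge0.
  apply/eqP/rowP => j; have := N0 j (mem_index_enum _).
  by rewrite mul_conjC_eq0 mxE => /eqP.
have H : \sum_j (v *m map_mx f A) 0 j * (v 0 j)^* = z * N.
  rewrite vA mulr_sumr; apply: eq_bigr => j _; by rewrite mxE mulrA.
have realz : z^* = z.
  apply: (mulIf N0); rewrite -H.
  have {1}-> : N = N^*.
    rewrite rmorph_sum; apply: eq_bigr => j _.
    by rewrite rmorphM /= conjCK mulrC.
  rewrite -rmorphM -H rmorph_sum.
  under eq_bigr do rewrite mxE rmorphM /= conjCK rmorph_sum mulr_suml.
  under [RHS]eq_bigr do rewrite mxE mulr_suml.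
  rewrite exchange_big; apply: eq_bigr => j _; apply: eq_bigr => k _ /=.
  rewrite rmorphM !mxE -[in RHS]symA mxE /=.
  have -> : (f (A j k))^* = f (A j k) by exact: conjc_real.
  by rewrite mulrAC [RHS]mulrAC; congr (_ * _); rewrite mulrC.
by case: z realz {H pE zz vA} => a b [] /eqP; rewrite eqNr => /eqP ->.
Qed.

End CharPoly.

(** * The spectrum of the Laplacian *)

Section Spectrum.
Variables (R : realType) (G : multigraph).
Implicit Types (sigma : edge G -> R).

Lemma laplacian_sym sigma : (laplacian sigma)^T = laplacian sigma.
Proof.
apply/matrixP => i j; rewrite !mxE eq_sym; case: eqP => [->//|_].
by rewrite finset.setUC.
Qed.

Lemma laplacian_apply sigma (v : 'rV[R]_#|vertex G|) i :
  (v *m laplacian sigma) 0 i = \sum_(e | enum_val i \in ends e)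
    sigma e * (v 0 i - v 0 (enum_rank (other e (enum_val i)))).
Proof.
rewrite mxE -laplacian_sym; under eq_bigr do rewrite mxE laplacianE mulr_sumr.
rewrite exchange_big; apply: eq_bigr => e _ /=.
have pick (k : 'I_#|vertex G|) : \sum_j v 0 j * (k == j)%:R = v 0 k.
  rewrite (bigD1 k) //= eqxx mulr1 big1 ?addr0 // => j jk.
  by rewrite eq_sym (negPf jk) mulr0.
under eq_bigr do rewrite mulrCA mulrBr.
by rewrite -mulr_sumr sumrB !pick.
Qed.

(** Maximum principle: evaluate the eigenvalue equation at a coordinate of
    maximal absolute value. *)
Lemma laplacian_eigenvalue_ge0 sigma a : positive_weight sigma ->
  eigenvalue (laplacian sigma) a -> 0 <= a.
Proof.
move=> sp /eigenvalueP[v vL v0].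
have [k vk] : exists k, v 0 k != 0.
  apply/existsP; apply: contraNT v0; rewrite negb_exists => /forallP v0.
  by apply/eqP/rowP => k; rewrite mxE; apply/eqP; have := v0 k; rewrite negbK.
case: (@arg_maxP _ _ _ k predT (fun k => `|v 0 k|) isT) => i _ imax.
have vi : 0 < v 0 i ^+ 2.
  rewrite exprn_even_gt0 //= -normr_gt0.
  by rewrite (lt_le_trans _ (imax k isT)) ?normr_gt0.
rewrite -(pmulr_lge0 _ vi) expr2 mulrA.
have := congr1 (fun w : 'rV_ _ => w 0 i) vL; rewrite [RHS]mxE.
move=> <-; rewrite laplacian_apply mulr_suml.
apply: sumr_ge0 => e _; rewrite -mulrA mulr_ge0 ?(ltW (sp e)) //.
rewrite mulrBl subr_ge0 -expr2 -real_normK ?num_real // expr2.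
by rewrite (le_trans (ler_norm _)) // normrM ler_wpM2r //; exact: imax.
Qed.

Lemma tree_sum_gt0 sigma : graph_connected G -> positive_weight sigma ->
  0 < tree_sum sigma.
Proof.
move=> cG sp; have /andP[/card_gt0P[r _] _] := cG.
have [f af _] := connected_arborescence r cG.
have w0 t : 0 < tree_weight sigma t by exact: prodr_gt0.
pose t0 : spanning_tree G := Sub (used_edges f) (spanning_tree_used_edges af).
rewrite /tree_sum (bigD1 t0) //=.
by rewrite ltr_pwDl // sumr_ge0 // => t _; exact: ltW.
Qed.

Lemma laplacian_root0 sigma : (0 < #|vertex G|)%N ->
  eigenvalue (laplacian sigma) 0.
Proof.
move=> n0; apply/eigenvalueP; exists (const_mx 1).
  apply/rowP => i; rewrite laplacian_apply scale0r [RHS]mxE big1 // => e _.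
  by rewrite !mxE subrr mulr0.
apply/eqP => /rowP/(_ (Ordinal n0)); rewrite !mxE => /eqP.
by rewrite oner_eq0.
Qed.

Lemma char_poly_laplacian_coef1 sigma :
  (char_poly (laplacian sigma))`_1 =
  (-1) ^+ #|vertex G|.-1 * (#|vertex G|%:R * tree_sum sigma).
Proof.
rewrite char_poly_coef1; congr (_ * _).
rewrite (eq_bigr (fun=> tree_sum sigma)) => [|r _].
  by rewrite sumr_const card_ord mulr_natl.
rewrite -(matrix_tree sigma (enum_val r)); congr (\det _).
by apply/matrixP => i j; rewrite !mxE (inj_eq enum_val_inj).
Qed.

Lemma pdet_laplacian sigma : graph_connected G -> positive_weight sigma ->
  pdet (laplacian sigma) = #|vertex G|%:R * tree_sum sigma.
Proof.
move=> cG sp; have /andP[n0 _] := cG.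
have [s pE] := symmetric_char_poly_split (laplacian_sym sigma).
have p0 : char_poly (laplacian sigma) != 0.
  by rewrite monic_neq0 ?char_poly_monic.
have rs a : (a \in s) = root (char_poly (laplacian sigma)) a.
  by rewrite pE root_prod_XsubC.
have szs : size s = #|vertex G|.
  have := size_char_poly (laplacian sigma).
  by rewrite pE size_prod_XsubC => -[].
(* [s'] lists the roots with one zero removed; the product of [s'] is nonzero,
   so [0] is a simple root. *)
have s0 : 0 \in s by rewrite rs -eigenvalue_root_char laplacian_root0.
have ps := perm_to_rem s0; set s' := rem 0 s in ps.
have szs' : size s' = #|vertex G|.-1 by rewrite size_rem ?szs.
have s'E : \prod_(a <- s') a = #|vertex G|%:R * tree_sum sigma.
  apply: (mulfI (negbT (signr_eq0 R #|vertex G|.-1))).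
  rewrite -char_poly_laplacian_coef1 pE (perm_big _ ps) /= big_cons subr0.
  rewrite coefXM /= coef0_prod -szs'.
  under [RHS]eq_bigr do rewrite coefB coefX coefC sub0r -mulN1r.
  by rewrite big_split /= big_const_seq count_predT iter_mulr_1.
have s'0 : {in s', forall a, 0 < a}.
  move=> a as'; rewrite lt_def andbC.
  rewrite (@laplacian_eigenvalue_ge0 sigma) //=; last first.
    by rewrite eigenvalue_root_char -rs (perm_mem ps) inE as' orbT.
  have : \prod_(a <- s') a != 0.
    by rewrite s'E mulf_neq0 ?pnatr_eq0 -?lt0n // gt_eqF // tree_sum_gt0.
  by rewrite prodf_seq_neq0 => /allP /(_ _ as').
have rE : perm_eq (rootsR (char_poly (laplacian sigma))) (undup s).
  apply: uniq_perm (undup_uniq _) _; first exact: uniq_roots.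
  move=> a; rewrite mem_undup rs.
  by have := roots_on_rootsR p0 a; rewrite in_itv.
rewrite -s'E /pdet (perm_big _ rE) /= pE.
under eq_bigr do rewrite mu_prod_XsubC.
rewrite (prodr_undup_exp_count s) (perm_big _ ps) /= big_cons ltxx.
rewrite big_seq_cond [RHS]big_seq; apply: eq_bigl => a.
by case: (boolP (a \in s')) => //= /s'0.
Qed.

End Spectrum.

(** * Gordan's alternative *)

Section Gordan.
Variables (K : realFieldType) (E : finType) (T : eqType).
Implicit Types (x y v : E -> K) (p : T -> E -> K) (s : seq T).

(** The standard bilinear form on functions [E -> K]. *)
Definition dot x y : K := \sum_e x e * y e.

Lemma dotDr x a y b v :
  dot x (fun e => a * y e + b * v e) = a * dot x y + b * dot x v.
Proof.
rewrite /dot !mulr_sumr -big_split; apply: eq_bigr => e _ /=; ring.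
Qed.

Lemma dotDl a x v y : dot (fun e => x e + a * v e) y = dot x y + a * dot v y.
Proof.
rewrite /dot !mulr_sumr -big_split; apply: eq_bigr => e _ /=; ring.
Qed.

(** Finitely many lower bounds [l i] and one upper bound [b / c] that are
    pairwise compatible leave room for a common solution; the bound is written
    as [t * c < b] so that [c = 0] is allowed. *)
Lemma between_finite_bounds s (l : T -> K) b c : s != [::] -> 0 <= c ->
  {in s, forall i, l i * c < b} ->
  exists t, {in s, forall i, l i < t} /\ t * c < b.
Proof.
move=> s0 c0 lb.
have [k [lk kb]] : exists k, {in s, forall i, l i <= k} /\ k * c < b.
  elim: s s0 lb => // i [|j s] IHs _ lb.
    exists (l i); split=> [i'|]; first by rewrite inE => /eqP ->.
    by apply: lb; rewrite mem_head.
  have [i' i's|k [lk kb]] := IHs isT; first by apply: lb; rewrite inE i's orbT.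
  exists (Num.max (l i) k); split=> [i'|].
    by rewrite inE le_max => /orP[/eqP ->|/lk->]; rewrite ?lexx ?orbT.
  by case: (leP (l i) k) => _ //; apply: lb; rewrite mem_head.
have c1 : 0 < c + 1 by lra.
exists (k + (b - k * c) / (c + 1)).
have e0 : 0 < (b - k * c) / (c + 1) by rewrite divr_gt0 // subr_gt0.
split=> [i /lk li|]; first by lra.
rewrite mulrDl -ltrBrDl mulrAC ltr_pdivrMr // ltr_pM2l; lra.
Qed.

(** Either [0] is a nontrivial nonnegative combination of the vectors [p i], or
    some [x] is positive on all of them. By induction on the number of vectors:
    if [x] is positive on the vectors of [s] but not on [p k], combine each of
    the former with [p k] into a vector orthogonal to [x], and apply the
    induction hypothesis to these combinations. *)
Theorem gordan p s : uniq s ->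
  (exists mu : T -> K, [/\ {in s, forall i, 0 <= mu i},
     0 < \sum_(i <- s) mu i & forall e, \sum_(i <- s) mu i * p i e = 0]) \/
  (exists x, {in s, forall i, 0 < dot x (p i)}).
Proof.
elim: s p => [|k s IHs] p /=; first by move=> _; right; exists (fun=> 0).
case/andP=> ks us.
have glue (a : K) (mu F : T -> K) :
    \sum_(i <- k :: s) (if i == k then a else mu i) * F i =
    a * F k + \sum_(i <- s) mu i * F i.
  rewrite big_cons eqxx; congr (_ + _); apply: eq_big_seq => i si.
  by case: eqP => // ik; rewrite -ik si in ks.
have glue1 (a : K) (mu : T -> K) :
    \sum_(i <- k :: s) (if i == k then a else mu i) = a + \sum_(i <- s) mu i.
  rewrite big_cons eqxx; congr (_ + _); apply: eq_big_seq => i si.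
  by case: eqP => // ik; rewrite -ik si in ks.
have [->|s0] := eqVneq s [::].
  have [pk|pk] := eqVneq (dot (p k) (p k)) 0; [left|right].
    exists (fun=> 1); split=> [i _||e]; rewrite ?big_seq1 ?ler01 ?ltr01 //.
    move/eqP: pk; rewrite psumr_eq0 => [/allP/(_ e (mem_index_enum _))|i _].
      by rewrite mulf_eq0 orbb mul1r => /eqP.
    by rewrite -expr2 sqr_ge0.
  exists (p k) => i; rewrite inE => /eqP ->; rewrite lt_def pk.
  by apply: sumr_ge0 => e _; rewrite -expr2 sqr_ge0.
have [[mu [mu0 mus mup]]|[x xs]] := IHs p us.
  left; exists (fun i => if i == k then 0 else mu i); split=> [i||e].
  - by rewrite inE; case: eqP => //= _; exact: mu0.
  - by rewrite glue1 add0r.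
  - by rewrite glue mul0r add0r.
have [xk|xk] := ltP 0 (dot x (p k)).
  by right; exists x => i; rewrite inE => /orP[/eqP ->//|]; exact: xs.
pose c := - dot x (p k); have c0 : 0 <= c by rewrite oppr_ge0.
have [[mu [mu0 mus mup]]|[y ys]] :=
  IHs (fun i e => dot x (p i) * p k e + c * p i e) us.
- left; set a := \sum_(i <- s) mu i * dot x (p i).
  have a0 : 0 < a.
    have a0' : forall i, i \in s -> 0 <= mu i * dot x (p i).
      by move=> i si; rewrite mulr_ge0 ?mu0 // ltW ?xs.
    rewrite lt_def /a big_seq sumr_ge0 // andbT.
    apply: contraTneq mus; move/eqP; rewrite psumr_eq0 // => /allP muE.
    rewrite -leNgt big_seq sumr_le0 // => i si.
    have := muE i si.
    by rewrite si /= mulf_eq0 (gt_eqF (xs i si)) orbF => /eqP ->.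
  exists (fun i => if i == k then a else c * mu i); split=> [i||e].
  - rewrite inE; case: eqP => [_ _|_ /= si]; first exact: ltW.
    by rewrite mulr_ge0 ?mu0.
  - rewrite glue1 -mulr_sumr ltr_wpDr // mulr_ge0 //; exact: ltW.
  - rewrite glue -[RHS](mup e) /a mulr_suml.
    under [RHS]eq_bigr do rewrite mulrDr !mulrA [mu _ * c]mulrC.
    by rewrite [RHS]big_split.
(* [y] is positive on the combinations; adding a multiple [t x] makes it
   positive on the original vectors and on [p k]. *)
have [i si|t [lt tb]] := @between_finite_bounds s
    (fun i => - dot y (p i) / dot x (p i)) (dot y (p k)) c s0 c0.
  have := ys i si; rewrite dotDr => h.
  rewrite mulrAC ltr_pdivrMr ?xs //; lra.
right; exists (fun e => y e + t * x e) => i; rewrite inE dotDl.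
case/orP=> [/eqP ->|si].
  by move: tb; rewrite /c mulrN; lra.
by have := lt i si; rewrite ltr_pdivrMr ?xs //; lra.
Qed.

End Gordan.

(** * First-order condition for exponential sums *)

Section FirstOrder.
Variables (R : realType).

Lemma expR_le_quadratic (y : R) : y <= 1 / 2 -> expR y <= 1 + y + 2 * y ^+ 2.
Proof.
move=> y2; have y1 : 0 < 1 - y by lra.
have h := expR_ge1Dx (- y); rewrite expRN in h.
have : expR y <= (1 - y)^-1.
  by rewrite -lef_pV2 ?invrK ?posrE ?invr_gt0 ?expR_gt0.
move=> /le_trans; apply; rewrite -div1r ler_pdivrMr // -subr_ge0.
have -> : (1 + y + 2 * y ^+ 2) * (1 - y) - 1 = y ^+ 2 * (1 - 2 * y) by ring.
by rewrite mulr_ge0 ?sqr_ge0 //; lra.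
Qed.

(** If [s |-> sum_i w_i exp (s x_i)] is minimal at [s = 0], then its derivative
    there vanishes. *)
Lemma exp_sum_first_order (I : finType) (w x : I -> R) :
    (forall i, 0 <= w i) ->
    (forall s, \sum_i w i <= \sum_i w i * expR (s * x i)) ->
  \sum_i w i * x i = 0.
Proof.
move=> w0 wmin; set A := \sum_i w i * x i.
pose B := \sum_i w i * (2 * x i ^+ 2); pose M := \sum_i `|x i|.
have B0 : 0 <= B.
  by apply: sumr_ge0 => i _; rewrite mulr_ge0 // mulr_ge0 ?sqr_ge0.
have M0 : 0 <= M by apply: sumr_ge0.
have xM i : `|x i| <= M by rewrite /M (bigD1 i) //= lerDl sumr_ge0.
(* The increment at [s] is at most [s A + s^2 B]; the step [- A / D] makes this
   negative unless [A = 0], and [D] is large enough for the quadratic bound on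
   the exponential to apply to every [s * x i]. *)
pose D := B + 1 + 2 * (`|A| * M).
have AM0 : 0 <= `|A| * M by rewrite mulr_ge0.
have D0 : 0 < D by rewrite /D; lra.
pose s := - A / D.
have quad : 0 <= s * A + s ^+ 2 * B.
  have := wmin s; rewrite -(lerD2r (- \sum_i w i)) subrr -sumrB.
  move=> /le_trans; apply.
  rewrite /A /B !mulr_sumr -big_split; apply: ler_sum => i _ /=.
  have sx : s * x i <= 1 / 2.
    apply: le_trans (ler_norm _) _.
    rewrite normrM normf_div normrN (gtr0_norm D0).
    rewrite mulrAC ler_pdivrMr //.
    have := ler_wpM2l (normr_ge0 A) (xM i); rewrite /D; lra.
  have := ler_wpM2l (w0 i) (expR_le_quadratic sx); lra.
have : s * A + s ^+ 2 * B = - ((A / D) ^+ 2 * (D - B)).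
  by rewrite /s; field; rewrite gt_eqF.
move=> sE; move: quad; rewrite sE oppr_ge0 => neg.
have DB : 0 < D - B by rewrite /D; lra.
have /eqP : (A / D) ^+ 2 = 0.
  by apply/le_anti; rewrite sqr_ge0 andbT -(pmulr_lle0 _ DB) .
rewrite sqrf_eq0 mulf_eq0 invr_eq0 (gt_eqF D0) orbF => /eqP //.
Qed.

End FirstOrder.

(** * Homogeneity and minimizers of the tree sum *)

Section Optimisation.
Variables (R : realType) (G : multigraph).
Implicit Types (sigma tau beta x : edge G -> R) (t : spanning_tree G).
Implicit Types (mu : spanning_tree G -> R).

Lemma card_spanning_tree t : #|val t| = #|vertex G|.-1.
Proof.
have /andP[cT /asboolP aT] := valP t.
have /andP[/card_gt0P[r _] _] := cT.
have [f af fT] := connected_arborescence r cT.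
by rewrite -(acyclic_used_edges_eq aT af fT) (card_used_edges af).
Qed.

(** A pmf on the edges forces an edge to exist, and an edge has two ends. *)
Lemma pos_pmf_card_vertex beta : is_pos_pmf beta -> (1 < #|vertex G|)%N.
Proof.
case=> -[_ b1] _; have [e _|noe] := pickP (fun _ : edge G => true).
  by have := max_card (mem (ends e)); rewrite card_ends.
move: b1; rewrite big_pred0 // => /esym/eqP; by rewrite oner_eq0.
Qed.

Lemma tree_weight_exp x t :
  tree_weight (fun e => expR (x e)) t = expR (\sum_(e in val t) x e).
Proof. by rewrite expR_sum. Qed.

Lemma expR_ln sigma : positive_weight sigma ->
  sigma = (fun e => expR (ln (sigma e))).
Proof. by move=> sp; apply/funext => e; rewrite lnK // posrE. Qed.

Lemma feasible_expR beta x :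
  feasible beta (fun e => expR (x e)) <-> dot beta x = 0.
Proof.
have -> : feasible beta (fun e => expR (x e)) <->
          \prod_e expR (x e) `^ beta e = 1.
  by split=> [[]//|h]; split=> // e; exact: expR_gt0.
have -> : \prod_e expR (x e) `^ beta e = expR (dot beta x).
  by rewrite expR_sum; apply: eq_bigr => e _; rewrite mulrC expRM.
by split=> [|->]; [rewrite -[1]expR0 => /expR_inj | rewrite expR0].
Qed.

Lemma sum_edge_usage mu x :
  \sum_e edge_usage mu e * x e = \sum_t mu t * \sum_(e in val t) x e.
Proof.
under eq_bigr do rewrite mulr_suml; under [RHS]eq_bigr do rewrite mulr_sumr.
by rewrite (exchange_big_dep predT).
Qed.

Lemma sum_edge_usage1 mu : is_pmf mu -> (0 < #|vertex G|)%N ->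
  \sum_e edge_usage mu e = #|vertex G|%:R - 1.
Proof.
move=> [_ mu1] n0; under eq_bigr do rewrite -[edge_usage _ _]mulr1.
rewrite sum_edge_usage; under eq_bigr do rewrite sumr_const card_spanning_tree.
by rewrite -mulr_suml mu1 mul1r -subn1 natrB.
Qed.

Lemma homogeneous_exp_sum_ge1 beta mu x : is_pmf mu ->
    (forall e, edge_usage mu e = (#|vertex G|%:R - 1) * beta e) ->
    dot beta x = 0 ->
  1 <= \sum_t mu t * expR (\sum_(e in val t) x e).
Proof.
move=> [mu0 mu1] muE bx.
have -> : 1 = \sum_t mu t * (1 + \sum_(e in val t) x e).
  under eq_bigr do rewrite mulrDr mulr1.
  rewrite big_split /= mu1 -sum_edge_usage.
  under [X in _ + X]eq_bigr do rewrite muE -mulrA.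
  by rewrite -mulr_sumr -/(dot beta x) bx mulr0 addr0.
by apply: ler_sum => t _; rewrite ler_wpM2l // expR_ge1Dx.
Qed.

Lemma pmf_le1 (X : finType) (p : X -> R) i : is_pmf p -> p i <= 1.
Proof. by case=> p0 <-; rewrite (bigD1 i) //= lerDl sumr_ge0. Qed.

(** The defining equation of homogeneity, cleared of its denominator. *)
Lemma edge_usage_homogeneous mu beta : (1 < #|vertex G|)%N ->
  (forall e, edge_usage mu e / (#|vertex G|%:R - 1) = beta e) <->
  (forall e, edge_usage mu e = (#|vertex G|%:R - 1) * beta e).
Proof.
move=> n1; have k0 : (#|vertex G|%:R - 1 : R) != 0.
  by rewrite gt_eqF // subr_gt0 ltr1n.
split=> h e; last by rewrite h mulrAC divff // mul1r.
by rewrite -h mulrC divfK.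
Qed.

Lemma homogeneous_tree_sum_ge1 beta sigma : is_pos_pmf beta ->
  homogeneous beta -> feasible beta sigma -> 1 <= tree_sum sigma.
Proof.
move=> bp [mu [mup /(edge_usage_homogeneous _ _ (pos_pmf_card_vertex bp)) muE]].
move=> fs; have [sp _] := fs; move: fs; rewrite (expR_ln sp).
move=> /feasible_expR /(homogeneous_exp_sum_ge1 mup muE) /le_trans; apply.
apply: ler_sum => t _; rewrite tree_weight_exp ler_piMl ?expR_ge0 //.
exact: pmf_le1.
Qed.

Lemma tree_weight_mul sigma tau t :
  tree_weight (fun e => sigma e * tau e) t =
  tree_weight sigma t * tree_weight tau t.
Proof. exact: big_split. Qed.

Lemma positive_tree_weight sigma t :
  positive_weight sigma -> 0 < tree_weight sigma t.
Proof. by move=> sp; exact: prodr_gt0. Qed.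

Lemma tree_pmfP sigma : graph_connected G -> positive_weight sigma ->
  is_pmf (tree_pmf sigma).
Proof.
move=> cG sp; have F0 := tree_sum_gt0 cG sp; split=> [t|].
  by rewrite divr_ge0 ?ltW // positive_tree_weight.
by rewrite -mulr_suml divff // gt_eqF.
Qed.

Lemma tree_sum_mul sigma x : graph_connected G -> positive_weight sigma ->
  tree_sum (fun e => sigma e * expR (x e)) =
  tree_sum sigma * \sum_t tree_pmf sigma t * expR (\sum_(e in val t) x e).
Proof.
move=> cG sp; rewrite mulr_sumr; apply: eq_bigr => t _.
rewrite tree_weight_mul tree_weight_exp mulrA mulrCA divff ?mulr1 //.
by rewrite gt_eqF // tree_sum_gt0.
Qed.

(** All trees have the same number of edges, so the scale cancels. *)
Lemma tree_pmf_scale sigma c : c != 0 ->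
  tree_pmf (fun e => sigma e * c) = tree_pmf sigma.
Proof.
move=> c0; have wE t : tree_weight (fun e => sigma e * c) t =
    tree_weight sigma t * c ^+ #|vertex G|.-1.
  by rewrite tree_weight_mul -(card_spanning_tree t) -prodr_const.
apply/funext => t; rewrite /tree_pmf wE /tree_sum.
under eq_bigr do rewrite wE.
by rewrite -mulr_suml -mulf_div divff ?mulr1 // expf_neq0.
Qed.

Lemma strictly_homogeneous_minimizer beta : graph_connected G ->
    is_pos_pmf beta -> strictly_homogeneous beta ->
  exists2 sigma, feasible beta sigma &
    forall tau, feasible beta tau -> tree_sum sigma <= tree_sum tau.
Proof.
move=> cG bp [sigma0 [sp0]].
move=> /(edge_usage_homogeneous _ _ (pos_pmf_card_vertex bp)) uE.
have [[_ b1] _] := bp.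
(* Rescaling [sigma0] by [exp c] makes it feasible, as [beta] sums to 1. *)
pose c := - dot beta (fun e => ln (sigma0 e)).
pose x e := ln (sigma0 e) + c.
have sE : (fun e => sigma0 e * expR c) = (fun e => expR (x e)).
  by rewrite [in LHS](expR_ln sp0); apply/funext => e; rewrite expRD.
have bx : dot beta x = 0.
  rewrite /dot; under eq_bigr do rewrite mulrDr.
  by rewrite big_split /= -mulr_suml b1 mul1r subrr.
exists (fun e => expR (x e)); first exact/feasible_expR.
move=> tau ft; have [tp _] := ft; pose y e := ln (tau e) - x e.
have by0 : dot beta y = 0.
  move: ft; rewrite (expR_ln tp) => /feasible_expR bt.
  rewrite /dot; under eq_bigr do rewrite mulrBr.
  by rewrite sumrB -/(dot _ _) -/(dot _ _) bt bx subrr.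
have xp : positive_weight (fun e => expR (x e)) by move=> e; exact: expR_gt0.
have -> : tau = (fun e => expR (x e) * expR (y e)).
  by rewrite {1}(expR_ln tp); apply/funext => e; rewrite -expRD addrC subrK.
rewrite (tree_sum_mul _ cG xp) ler_peMr ?(ltW (tree_sum_gt0 cG xp)) //.
apply: homogeneous_exp_sum_ge1 by0; first exact: tree_pmfP.
by move=> e; rewrite -uE -sE tree_pmf_scale // gt_eqF // expR_gt0.
Qed.

Lemma minimizer_strictly_homogeneous beta sigma : graph_connected G ->
    is_pos_pmf beta -> feasible beta sigma ->
    (forall tau, feasible beta tau -> tree_sum sigma <= tree_sum tau) ->
  strictly_homogeneous beta.
Proof.
move=> cG bp fs smin; have [[_ b1] b0] := bp; have [sp _] := fs.
have n1 := pos_pmf_card_vertex bp.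
exists sigma; split=> //; apply/(edge_usage_homogeneous _ _ n1).
have pP := tree_pmfP cG sp; set U := edge_usage _.
set k := #|vertex G|%:R - 1.
have kU : \sum_e U e = k by rewrite sum_edge_usage1 // ltnW.
(* This direction is orthogonal to [beta], and to [U] by minimality; hence
   [sum_e beta e * x e ^ 2 = <U, x> - k <beta, x> = 0]. *)
pose x e := U e / beta e - k.
have bx e : beta e * x e = U e - k * beta e.
  by rewrite /x; field; rewrite gt_eqF.
have dbx : dot beta x = 0.
  rewrite /dot; under eq_bigr do rewrite bx.
  by rewrite sumrB -mulr_sumr b1 kU mulr1 subrr.
have Ux : \sum_e U e * x e = 0.
  rewrite sum_edge_usage; apply: exp_sum_first_order; first by case: pP.
  move=> s; have [_ ->] := pP.
  have /smin : feasible beta (fun e => sigma e * expR (s * x e)).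
    move: fs; rewrite (expR_ln sp) => /feasible_expR fs.
    have -> : (fun e => expR (ln (sigma e)) * expR (s * x e)) =
              (fun e => expR (ln (sigma e) + s * x e)).
      by apply/funext => e; rewrite expRD.
    apply/feasible_expR; have := dotDr beta 1 (fun e => ln (sigma e)) s x.
    by under eq_fun do rewrite mul1r; rewrite fs dbx !mulr0 addr0.
  rewrite (tree_sum_mul _ cG sp) ler_pMr ?tree_sum_gt0 //.
  by under eq_bigr do rewrite -mulr_sumr.
have : \sum_e beta e * x e ^+ 2 = 0.
  under eq_bigr do rewrite expr2 mulrA bx mulrBl -mulrA.
  by rewrite sumrB Ux -mulr_sumr -/(dot beta x) dbx mulr0 subrr.
move/eqP; rewrite psumr_eq0 => [/allP x0 e|e _]; last first.
  by rewrite mulr_ge0 ?sqr_ge0 // ltW.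
have := x0 e (mem_index_enum _).
rewrite /= mulf_eq0 gt_eqF //= sqrf_eq0 => /eqP xe.
by apply/eqP; rewrite -subr_eq0 -bx xe mulr0.
Qed.

Lemma not_homogeneous_descent beta : is_pos_pmf beta -> ~ homogeneous beta ->
  exists x, dot beta x = 0 /\ forall t, \sum_(e in val t) x e < 0.
Proof.
move=> bp nh; have [[_ b1] _] := bp; have n1 := pos_pmf_card_vertex bp.
set k : R := #|vertex G|%:R - 1.
have kE : k = #|vertex G|.-1%:R by rewrite /k -subn1 natrB // ltnW.
have [[mu [mu0 mus mup]]|[y yp]] :=
  gordan (fun t e => k * beta e - (e \in val t)%:R)
    (index_enum_uniq (spanning_tree G)).
  case: nh; pose M := \sum_t mu t; exists (fun t => mu t / M); split.
    split=> [t|]; last by rewrite -mulr_suml divff // gt_eqF.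
    by rewrite divr_ge0 ?mu0 ?mem_index_enum // ltW.
  apply/(edge_usage_homogeneous _ _ n1) => e.
  rewrite /edge_usage -mulr_suml; apply: (canLR (mulfK (lt0r_neq0 mus))).
  have := mup e; under eq_bigr do rewrite mulrBr; rewrite sumrB -mulr_suml.
  move=> /eqP; rewrite subr_eq0 mulrC => /eqP ->.
  by rewrite big_mkcond; apply: eq_bigr => t _; case: ifP; rewrite ?mulr1 ?mulr0.
(* Subtracting the constant [<beta, y>] makes [y] orthogonal to [beta] and its
   total on each tree negative. *)
exists (fun e => y e - dot beta y); split.
  rewrite {1}/dot; under eq_bigr do rewrite mulrBr.
  by rewrite sumrB -mulr_suml b1 mul1r subrr.
move=> t; rewrite sumrB sumr_const card_spanning_tree -mulr_natl -kE subr_lt0.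
have := yp t (mem_index_enum _); rewrite /dot.
under eq_bigr do rewrite mulrBr mulrCA.
rewrite sumrB -mulr_sumr subr_gt0; congr (_ < _).
  rewrite [RHS]big_mkcond; apply: eq_bigr => e _; case: ifP; rewrite ?mulr1 ?mulr0 //.
by congr (_ * _); apply: eq_bigr => e _; rewrite mulrC.
Qed.

Lemma descent_tree_sum_small beta x eps : graph_connected G ->
    dot beta x = 0 -> (forall t, \sum_(e in val t) x e < 0) -> 0 < eps ->
  exists2 sigma, feasible beta sigma & tree_sum sigma < eps.
Proof.
move=> cG bx xt eps0; pose N : R := #|spanning_tree G|%:R.
have /andP[/card_gt0P[r _] _] := cG.
have [f af _] := connected_arborescence r cG.
pose t0 : spanning_tree G := Sub (used_edges f) (spanning_tree_used_edges af).
have N0 : 0 < N by rewrite ltr0n; apply/card_gt0P; exists t0.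
have [|t _|m [xm]] := @between_finite_bounds _ _ (index_enum (spanning_tree G))
    (fun t => \sum_(e in val t) x e) 0 1 _ ler01.
- by apply/eqP => e0; have := mem_index_enum t0; rewrite e0.
- by rewrite mulr1.
(* All tree totals are below [m < 0]; with this [s], the
   upper bound [N / (1 - s m)] on [N exp (s m)] equals [eps N / (eps + N)]. *)
rewrite mulr1 => m0; pose s := N / (eps * - m).
have s0 : 0 < s by rewrite divr_gt0 ?mulr_gt0 ?oppr_gt0.
exists (fun e => expR (s * x e)).
  apply/feasible_expR; rewrite /dot; under eq_bigr do rewrite mulrCA.
  by rewrite -mulr_sumr -/(dot beta x) bx mulr0.
apply: (@le_lt_trans _ _ (N * expR (s * m))).
  rewrite mulr_natl -sumr_const; apply: ler_sum => t _.
  rewrite tree_weight_exp -mulr_sumr ler_expR ler_pM2l //.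
  by rewrite ltW // xm // mem_index_enum.
rewrite -[s * m]opprK expRN ltr_pdivrMr ?expR_gt0 //.
have h : 1 + - (s * m) <= expR (- (s * m)) by exact: expR_ge1Dx.
apply: lt_le_trans (ler_wpM2l (ltW eps0) h).
have -> : eps * (1 + - (s * m)) = eps + N.
  by rewrite /s; field; rewrite (gt_eqF eps0) (lt_eqF m0).
by rewrite ltrDr.
Qed.

End Optimisation.

(** * The variational characterisation *)

Local Open Scope classical_set_scope.
Local Open Scope ring_scope.

Theorem theorem1p8 (R : realType) (G : multigraph) (beta : edge G -> R) :
  graph_connected G -> is_pos_pmf beta ->
  [/\ forall sigma : edge G -> R, positive_weight sigma ->
        tree_sum sigma = #|vertex G|%:R^-1 * pdet (laplacian sigma),
      0 < inf [set pdet (laplacian sigma) | sigma in feasible beta] <->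
        homogeneous beta &
      (exists2 sigma, feasible beta sigma &
         forall tau, feasible beta tau -> tree_sum sigma <= tree_sum tau) <->
        strictly_homogeneous beta].
Proof.
move=> cG bp; have n0 : 0 < #|vertex G|%:R :> R by rewrite ltr0n; case/andP: cG.
split.
- by move=> sigma sp; rewrite pdet_laplacian // mulKf ?gt_eqF.
- split=> [inf0|hb].
    apply: contrapT => /(not_homogeneous_descent bp)[x [bx xt]].
    have e0 := divr_gt0 inf0 n0.
    have [sigma fs] := descent_tree_sum_small cG bx xt e0.
    have [sp _] := fs; rewrite ltr_pdivlMr // mulrC -pdet_laplacian //.
    apply/negP; rewrite -leNgt; apply: ge_inf; last by exists sigma.
    exists 0 => _ [tau [tp _] <-]; rewrite pdet_laplacian //.
    by rewrite mulr_ge0 ?ltW // tree_sum_gt0.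
  apply: lt_le_trans n0 (lb_le_inf _ _).
    exists (pdet (laplacian (fun e : edge G => expR (0 : R)))).
    exists (fun e => expR 0) => //; apply/feasible_expR.
    by rewrite /dot big1 // => e _; rewrite mulr0.
  move=> _ [sigma fs <-]; have [sp _] := fs.
  by rewrite pdet_laplacian // ler_peMr ?ler0n // (homogeneous_tree_sum_ge1 bp hb fs).
- split=> [[sigma fs smin]|]; last exact: strictly_homogeneous_minimizer.
  exact: minimizer_strictly_homogeneous cG bp fs smin.
Qed.
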